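(* Let $\ell$ and $m$ be positive integers such that $\ell\ge m$. For integers $n_1\ge n_2\ge n_3\ge \max\{\ell+2,3\ell-2m-1\}$, the graph $G_1$ and the graphs $G_2^1,G_2^2,G_2^3$ with parameters $(\ell,m,n_1,n_2,n_3)$ defined in the context are $K_{\ell,m,m}$-saturated subgraphs of $K_{n_1,n_2,n_3}$. Thus, $$\operatorname{sat}(K_{n_1,n_2,n_3},K_{\ell,m,m})\le 2m(n_1+n_2+n_3)+(\ell-m)(n_2+2n_3)-3\ell m-3.$$
   Context: All graphs are simple, and $[k]=\{1,\dots,k\}$. For graphs $F$ and $H$, a subgraph $G$ of $H$ (with $V(G)=V(H)$) is an $F$-saturated subgraph of $H$ if $G$ contains no copy of $F$ as a (not necessarily induced) subgraph, but $G+e$ contains a copy of $F$ for every $e\in E(H)\setminus E(G)$. The number $\operatorname{sat}(H,F)$ is the minimum number of edges in an $F$-saturated subgraph of $H$. The host graph $K_{n_1,n_2,n_3}$ is the complete tripartite graph with partite sets $V_1,V_2,V_3$, where $V_i=\{v_i^1,\dots,v_i^{n_i}\}$. The graph $K_{a,b,c}$ is the complete tripartite graph with part sizes $a,b,c$. Arithmetic in subscripts is modulo 3 (with values in $[3]$). Graph $G_1$: For $i\in[3]$ let $S_i=\{v_i^{n_i-m+1},\dots,v_i^{n_i}\}$ (the last $m$ vertices of $V_i$), and join every vertex of $S_i$ to all vertices of $V_{i+1}\cup V_{i+2}$. If $\ell>m$, also add the following edges, where superscripts of vertices in $V_i$ are taken modulo $n_i-m$ with representatives in $\{1,\dots,n_i-m\}$: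 (1) for each $a\in[n_3-m]$, join $v_3^a$ to all of $\{v_1^a,\dots,v_1^{a+\ell-m-1}\}\cup\{v_2^a,\dots,v_2^{a+\ell-m-1}\}$; (2) for each $a\in[n_2-m]$, join $v_2^a$ to all of $\{v_1^{a+\ell-m},\dots,v_1^{a+2\ell-2m-1}\}$. Finally, in all cases, delete the three edges $v_1^{n_1}v_2^{n_2}$, $v_1^{n_1}v_3^{n_3}$, $v_2^{n_2}v_3^{n_3}$. Graph $G_2^i$ (for $i\in[3]$): constructed exactly as $G_1$, except that in the final step one deletes the three edges $v_i^{n_i}v_{i+1}^{n_{i+1}}$, $v_i^{n_i-1}v_{i+2}^{n_{i+2}}$, $v_{i+1}^{n_{i+1}}v_{i+2}^{n_{i+2}}$ instead of $v_1^{n_1}v_2^{n_2}$, $v_1^{n_1}v_3^{n_3}$, $v_2^{n_2}v_3^{n_3}$.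
   Formalization: The claim that G_2^1, G_2^2, G_2^3 are saturated is stated only for m ≥ 2; for m = 1 it is always false, since the kept edge v_i^{n_i}v_{i+2}^{n_{i+2}} has at least ℓ+1 common neighbours in V_{i+1}, giving a K_{ℓ,1,1}. *)

(* Defs.v *)
From HB Require Import structures.
From mathcomp Require Import all_boot.

Set Implicit Arguments.
Unset Strict Implicit.
Unset Printing Implicit Defensive.

Record sgraph (T : finType) := SGraph {
  edges : {set {set T}};
  edgesP : [forall e in edges, #|e| == 2]
}.

HB.instance Definition _ (T : finType) := [isSub for @edges T].
HB.instance Definition _ (T : finType) := [Finite of sgraph T by <:].

Lemma of_edges_subproof (T : finType) (E : {set {set T}}) :
  [forall e in [set e in E | #|e| == 2], #|e| == 2].
Proof. by apply/forall_inP => e; rewrite inE => /andP[]. Qed.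

(* The elements of E that are not 2-element sets are dropped. *)
Definition of_edges (T : finType) (E : {set {set T}}) : sgraph T :=
  SGraph (of_edges_subproof E).

(* Vertices x != y are adjacent when r x y or r y x. *)
Definition of_rel (T : finType) (r : rel T) : sgraph T :=
  of_edges [set [set p.1; p.2] | p : T * T & r p.1 p.2].

Definition add_edge (T : finType) (G : sgraph T) (e : {set T}) : sgraph T :=
  of_edges (e |: edges G).

Definition del_edges (T : finType) (G : sgraph T) (D : {set {set T}}) :
    sgraph T :=
  of_edges (edges G :\: D).

(* G contains a (not necessarily induced) copy of F. *)
Definition contains (U T : finType) (F : sgraph U) (G : sgraph T) : bool :=
  [exists f : {ffun U -> T},
     injectiveb f && [forall e in edges F, f @: e \in edges G]].

Definition saturated (U T : finType) (H : sgraph T) (F : sgraph U)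
    (G : sgraph T) : bool :=
  [&& edges G \subset edges H,
      ~~ contains F G &
      [forall e in edges H :\: edges G, contains F (add_edge G e)]].

(* Every subgraph of H has at most #|edges H| edges, so the default value of
   the minimum is only taken when it is attained or when H has no F-saturated
   subgraph at all. *)
Definition sat (U T : finType) (H : sgraph T) (F : sgraph U) : nat :=
  \big[minn/#|edges H|]_(G : sgraph T | saturated H F G) #|edges G|.

(* The partite sets V_1, V_2, V_3 are indexed by 0, 1, 2 : 'I_3, so that
   subscript i + 1 modulo 3 is [ordS i]. *)
Definition part1 : 'I_3 := Ordinal (isT : 0 < 3).
Definition part2 : 'I_3 := Ordinal (isT : 1 < 3).
Definition part3 : 'I_3 := Ordinal (isT : 2 < 3).

Definition sizes (a b c : nat) (i : 'I_3) : nat := nth 0 [:: a; b; c] i.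

Definition tripartite (a b c : nat) : finType :=
  {i : 'I_3 & 'I_(sizes a b c i)}.

Definition part (a b c : nat) (x : tripartite a b c) : 'I_3 := tag x.

(* Superscripts start at 1: the vertex v_i^s has part i and superscript s. *)
Definition sup (a b c : nat) (x : tripartite a b c) : nat := (tagged x).+1.

Definition complete_tripartite (a b c : nat) : sgraph (tripartite a b c) :=
  of_rel (fun x y => part x != part y).

(* The representative in {1, ..., N} of s modulo N, for 0 < s. *)
Definition wrap (N s : nat) : nat := (s.-1 %% N).+1.

Section Construction.

Variables (l m n1 n2 n3 : nat).

Let n : 'I_3 -> nat := sizes n1 n2 n3.
Let V : finType := tripartite n1 n2 n3.

Definition inS (x : V) : bool := n (part x) - m < sup x.

(* As k ranges over 'I_(l - m), the next two relations are empty if l = m. *)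
Definition join1 (x y : V) : bool :=
  [&& part x == part3, sup x <= n3 - m,
      (part y == part1) || (part y == part2) &
      [exists k : 'I_(l - m), sup y == wrap (n (part y) - m) (sup x + k)]].

Definition join2 (x y : V) : bool :=
  [&& part x == part2, sup x <= n2 - m, part y == part1 &
      [exists k : 'I_(l - m), sup y == wrap (n1 - m) (sup x + (l - m) + k)]].

Definition base_graph : sgraph V :=
  of_rel (fun x y => [|| inS x && (part x != part y), join1 x y | join2 x y]).

(* The set whose only element is the edge v_i^s v_j^t. *)
Definition edge_at (i : 'I_3) (s : nat) (j : 'I_3) (t : nat) : {set {set V}} :=
  [set [set p.1; p.2] | p : V * V &
     [&& part p.1 == i, sup p.1 == s, part p.2 == j & sup p.2 == t]].

Definition G1 : sgraph V :=
  del_edges base_graph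
    (edge_at part1 n1 part2 n2 :|: edge_at part1 n1 part3 n3
       :|: edge_at part2 n2 part3 n3).

(* If m = 1, then v_i^(n_i - 1) lies outside S_i and the edge v_i^(n_i) v_k^(n_k)
   is kept; its ends have n_j - 1 common neighbours in V_j, so that the graph
   contains K_{l,1,1} as soon as l < n_j. *)
Definition G2 (i : 'I_3) : sgraph V :=
  let j := ordS i in
  let k := ordS j in
  del_edges base_graph
    (edge_at i (n i) j (n j) :|: edge_at i (n i - 1) k (n k)
       :|: edge_at j (n j) k (n k)).

End Construction.

(* Main.v *)
Require Import Defs.
From mathcomp Require Import all_boot zify.

(** Write V_i for the partite sets and S for the union of the sets S_i. Up to
    the three deleted edges, the graphs consist of all edges of the host meeting
    S and of a core graph on the complement of S. The core has no triangle, a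
    vertex has at most l - m core neighbours in each partite set, and exactly
    l - m of them in each partite set of smaller index. One edge between S_i and
    S_j is deleted for each of the three pairs, in such a way that for at most
    one i the two deleted edges that meet S_i meet it in different vertices.

    No copy of K_{l,m,m} ([contains_trimmed_free]). Each part of a copy lies in
    one partite set, and different parts in different partite sets. As the core
    has no triangle, one of the parts lies in S, hence is some S_i. It has size
    m, so one of the other two parts, inside V_j say, has size at least l; the
    third part cannot lie in S as well, since it would be S_k, which is not
    completely joined to S_i because of the deleted edge. It thus has a vertex z
    outside S, and z has at most m + (l - m) = l neighbours in V_j. So the part
    in V_j consists of all of them, hence contains S_j, and the deleted edge
    between S_i and S_j is a contradiction.

    Saturation. If a deleted edge between S_i and S_j is put back, then S_i and
    S_j are completely joined, and V_k without the at most two ends of the other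
    deleted edges has at least l vertices ([contains_add_deleted_edge]). If xy
    is a missing core edge with x in V_i, y in V_j and i < j, the three parts
    are S_k, the vertex y with S_j minus one vertex, and the vertex x with the
    l - m core neighbours of y in V_i and S_i minus one vertex; the two vertices
    left out can be chosen to meet all three deleted edges
    ([contains_add_core_edge]).

    Edge count ([card_trimmed_edges]). Before the deletion, a vertex of V_j
    outside S has at most l neighbours in V_i for each i < j, so there are at
    most m n_i + l (n_j - m) edges between V_i and V_j, and one is deleted.

    The core of the actual graphs has no triangle because going from V_3 to V_1
    through V_2 shifts superscripts by an amount between l - m and
    3 (l - m) - 2, perhaps reduced by n_2 - m, and going directly shifts them by
    less than l - m ([jump_no_triangle]). The two shifts differ modulo n_1 - m
    because n_1 >= n_2 >= 3 l - 2 m - 1. *)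

Set Implicit Arguments.
Unset Strict Implicit.
Unset Printing Implicit Defensive.

(** * Edges of simple graphs *)

Section Graphs.
Variable T : finType.
Implicit Types (G : sgraph T) (x y u v : T) (A B C e : {set T}).

Lemma eq_set2 x y u v :
  ([set x; y] == [set u; v]) =
    (x == u) && (y == v) || (x == v) && (y == u).
Proof.
apply/eqP/orP => [E|[]/andP[/eqP-> /eqP->] //]; last by rewrite setUC.
have: x \in [set u; v] by rewrite -E set21.
have: y \in [set u; v] by rewrite -E set22.
have: u \in [set x; y] by rewrite E set21.
have: v \in [set x; y] by rewrite E set22.
rewrite !inE (eq_sym u x) (eq_sym u y) (eq_sym v x) (eq_sym v y).
by case: (x == u); case: (x == v); case: (y == u); case: (y == v); auto.
Qed.

Lemma card_edge G e : e \in edges G -> #|e| == 2.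
Proof. by move/(forall_inP (edgesP G)). Qed.

Lemma edge_neq G x y : [set x; y] \in edges G -> x != y.
Proof. by move/card_edge; rewrite cards2; case: (x != y). Qed.

Lemma in_of_rel (r : rel T) x y :
  ([set x; y] \in edges (of_rel r)) = (x != y) && (r x y || r y x).
Proof.
rewrite inE cards2 andbC; case: (x != y) => //=.
apply/imsetP/orP => [[[u v] /= ruv /eqP]|[rxy|ryx]].
- rewrite inE /= in ruv; rewrite eq_set2.
  by case/orP=> /andP[/eqP-> /eqP->]; [left|right].
- by exists (x, y); rewrite ?inE.
- by exists (y, x); rewrite ?inE //= setUC.
Qed.

Lemma in_del_edges G (D : {set {set T}}) e :
  (e \in edges (del_edges G D)) = (e \notin D) && (e \in edges G).
Proof.
rewrite !inE -andbA; case: (boolP (e \in edges G)) => [/card_edge->|_].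
  by rewrite andbT.
by rewrite !andbF.
Qed.

Lemma in_add_edge G e e' :
  #|e| == 2 -> (e' \in edges (add_edge G e)) = (e' == e) || (e' \in edges G).
Proof.
move=> e2; rewrite !inE; case: eqP => [->|_] //=.
by apply/andP/idP => [[]|eG] //; rewrite (card_edge eG).
Qed.

End Graphs.

(** * Copies of complete tripartite graphs *)

Section Containment.
Variable T : finType.
Implicit Types (G : sgraph T) (x y u v : T) (A B C e : {set T}).

Definition joined G A B :=
  forall x y, x \in A -> y \in B -> [set x; y] \in edges G.

Lemma joinedC G A B : joined G A B -> joined G B A.
Proof. by move=> AB x y xB yA; rewrite setUC; apply: AB. Qed.

(** The copy is injective across the three sets because an edge has two distinct
    ends. *)
Lemma contains_tripartite a b c G A B C :
  a <= #|A| -> b <= #|B| -> c <= #|C| ->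
  joined G A B -> joined G A C -> joined G B C ->
  contains (complete_tripartite a b c) G.
Proof.
move=> leA leB leC AB AC BC.
pose X (i : 'I_3) := nth set0 [:: A; B; C] i.
have leX i : sizes a b c i <= #|X i| by case: i => [[|[|[|]]]].
have joinX i j : i != j -> joined G (X i) (X j).
  by case: i j => [[|[|[|]]]] // ? [[|[|[|]]]] // ? _;
     rewrite /X //=; apply: joinedC.
pose f (v : tripartite a b c) := enum_val (widen_ord (leX (tag v)) (tagged v)).
have fX p : f p \in X (tag p) by apply: enum_valP.
apply/existsP; exists [ffun v => f v]; apply/andP; split.
  apply/injectiveP => v w; rewrite !ffunE => fvw.
  have [tvw|/joinX Xvw] := eqVneq (tag v) (tag w); last first.
    by have := edge_neq (Xvw _ _ (fX v) (fX w)); rewrite fvw eqxx.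
  case: v w tvw fvw => [i s] [j t] /= ij; rewrite -{j}ij in t *.
  by move/enum_val_inj/(congr1 val) => /= st; congr existT; apply: val_inj.
apply/forall_inP => e eF; have /cards2P[v [w [vw e_vw]]] := card_edge eF.
move: eF; rewrite e_vw in_of_rel vw /part /= [tag w == _]eq_sym orbb.
by rewrite imsetU1 imset_set1 !ffunE => /joinX; apply.
Qed.

Lemma contains_tripartite_sets a b c G :
  contains (complete_tripartite a b c) G ->
  exists2 X : 'I_3 -> {set T}, (forall i, #|X i| = sizes a b c i)
    & forall i j, i != j -> joined G (X i) (X j).
Proof.
case/existsP => f /andP[/injectiveP f_inj /forall_inP fE].
pose vtx i (s : 'I_(sizes a b c i)) : tripartite a b c :=
  Tagged (fun i => 'I_(sizes a b c i)) s.
exists (fun i => [set f (vtx i s) | s : 'I_(sizes a b c i)]).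
  move=> i; rewrite card_imset ?card_ord // => s t /f_inj/eqP.
  by rewrite eq_Tagged => /eqP.
move=> i j ij _ _ /imsetP[s _ ->] /imsetP[t _ ->].
have /fE: [set vtx i s; vtx j t] \in edges (complete_tripartite a b c).
  rewrite in_of_rel /part /= ij andbT.
  by apply: contraNneq ij => /(congr1 tag)/= ->.
by rewrite imsetU1 imset_set1.
Qed.

Lemma sat_le U (H : sgraph T) (F : sgraph U) G :
  saturated H F G -> sat H F <= #|edges G|.
Proof.
rewrite /sat => sG; have: G \in index_enum (sgraph T) by rewrite mem_index_enum.
elim: (index_enum _) => //= G' s IHs; rewrite big_cons inE => /orP[/eqP<-|/IHs].
  by rewrite sG geq_minl.
by case: ifP => // _; apply: leq_trans (geq_minr _ _).
Qed.

End Containment.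

(** * Saturation for an abstract hub and core *)

Lemma third (i j : 'I_3) : exists2 k : 'I_3, k != i & k != j.
Proof.
by case: i j => [[|[|[|]]]] // ? [[|[|[|]]]] // ?;
   first [by exists part1 | by exists part2 | by exists part3].
Qed.

Lemma cover3 (i j k p : 'I_3) :
  i != j -> i != k -> j != k -> [|| p == i, p == j | p == k].
Proof.
rewrite -!val_eqE /=.
by move: (ltn_ord i) (ltn_ord j) (ltn_ord k) (ltn_ord p); lia.
Qed.

Lemma card_bigcup_le (I T : finType) (P : {pred I}) (F : I -> {set T}) :
  #|\bigcup_(i in P) F i| <= \sum_(i in P) #|F i|.
Proof.
elim/big_rec2: _ => [|i n A _ IH]; first by rewrite cards0.
by apply: leq_trans (leq_card_setU _ _) _; rewrite leq_add2l.
Qed.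

(** The hub is [S], and a class is a partite set. The vertex [d i j] is the end
    in class [i] of the deleted edge between the classes [i] and [j];
    [d_stable] says that [d i j] depends on [j] for at most one class [i]. *)
Section Trimmed.

Variables (T : finType) (col : T -> 'I_3) (S : {set T}) (core : rel T).
Variables (d : 'I_3 -> 'I_3 -> T) (l m : nat) (G : sgraph T).

Let V i : {set T} := [set x | col x == i].
Let N x i : {set T} := [set y in V i | core x y].

Hypotheses (m_gt0 : 0 < m) (le_ml : m <= l).
Hypothesis card_S : forall i, #|S :&: V i| = m.
Hypothesis card_V : forall i, l + 2 <= #|V i|.
Hypothesis coreC : symmetric core.
Hypothesis core_notS : forall x y, core x y -> x \notin S.
Hypothesis core_no_triangle :
  forall x y z, core x y -> core y z -> core x z -> False.
Hypothesis core_le : forall x i, #|N x i| <= l - m.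
Hypothesis core_eq :
  forall x (i : 'I_3), x \notin S -> i < col x -> #|N x i| = l - m.
Hypothesis dS : forall i j, d i j \in S.
Hypothesis col_d : forall i j, col (d i j) = i.
Hypothesis d_stable : forall i j k, i != j -> i != k -> j != k ->
  d i j = d i k \/ d j i = d j k.

Let base x y := (col x != col y) && [|| x \in S, y \in S | core x y].
Let deleted x y := (x == d (col x) (col y)) && (y == d (col y) (col x)).

Hypothesis edgesG : forall x y,
  ([set x; y] \in edges G) = base x y && ~~ deleted x y.

Lemma edge_col x y : [set x; y] \in edges G -> col x != col y.
Proof. by rewrite edgesG => /andP[/andP[]]. Qed.

(** Two parts of a copy cannot both contain the hub of their class, because of
    the deleted edge between these hubs. A part inside [S] is a hub, and it
    forces a large part to contain its hub too. *)
Lemma contains_trimmed_free : ~~ contains (complete_tripartite l m m) G.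
Proof.
apply/negP => /contains_tripartite_sets[X cardX joinX].
have le_mX i : m <= #|X i| by rewrite cardX; case: i => [[|[|[|]]]].
have witness i : exists x, x \in X i.
  by apply/card_gt0P; apply: leq_trans (le_mX i).
have joined_col i j x y : i != j -> x \in X i -> y \in X j -> col x != col y.
  by move=> ij xi yj; apply: edge_col (joinX i j ij _ _ xi yj).
(* Adjacent vertices of the two other parts leave a single class to part [i]. *)
have [pi piE] : exists pi : 'I_3 -> 'I_3, forall i x, x \in X i -> col x = pi i.
  have mono i x x' : x \in X i -> x' \in X i -> col x = col x'.
    move=> xi x'i; have [j ji _] := third i i; have [k ki kj] := third i j.
    have [y yj] := witness j; have [z zk] := witness k.
    have [zy zx] := (joined_col _ _ _ _ kj zk yj, joined_col _ _ _ _ ki zk xi).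
    have yx := joined_col _ _ _ _ ji yj xi.
    have := cover3 (col x') zy zx yx; rewrite !(eq_sym (col x')).
    rewrite (negPf (joined_col _ _ _ _ ki zk x'i)).
    by rewrite (negPf (joined_col _ _ _ _ ji yj x'i)) => /eqP.
  exists (fun i => col (xchoose (witness i))) => i x xi.
  exact: mono xi (xchooseP _).
have pi_inj i j : i != j -> pi i != pi j.
  move=> ij; have [[x xi] [y yj]] := (witness i, witness j).
  by rewrite -(piE i x) // -(piE j y) // (joined_col i j).
have X_V i : X i \subset V (pi i).
  by apply/subsetP => x /piE; rewrite inE => ->.
have not_both i j : i != j ->
    S :&: V (pi i) \subset X i -> S :&: V (pi j) \subset X j -> False.
  move=> ij /subsetP Si /subsetP Sj.
  have di : d (pi i) (pi j) \in X i by rewrite Si // inE dS inE col_d eqxx.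
  have dj : d (pi j) (pi i) \in X j by rewrite Sj // inE dS inE col_d eqxx.
  have := joinX i j ij _ _ di dj.
  by rewrite edgesG /deleted !col_d !eqxx andbF.
have S_full i : X i \subset S -> X i = S :&: V (pi i).
  move=> XiS; apply/eqP; rewrite eqEcard card_S le_mX andbT.
  by rewrite subsetI XiS X_V.
(* A vertex [z] of part [i] outside [S] has at most [l] neighbours in the class
   of part [j], so part [j] must consist of all of them. *)
have absorbs i j : i != j -> l <= #|X j| -> ~~ (X i \subset S) ->
    S :&: V (pi j) \subset X j.
  move=> ij le_lX /subsetPn[z zi zS].
  have sub : X j \subset (S :&: V (pi j)) :|: N z (pi j).
    apply/subsetP => y yj; have := joinX i j ij _ _ zi yj.
    rewrite edgesG /base (negPf zS) => /andP[/andP[_ /=]].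
    by rewrite !inE (piE j) // eqxx andbT => ->.
  suff -> : X j = (S :&: V (pi j)) :|: N z (pi j) by apply: subsetUl.
  apply/eqP; rewrite eqEcard sub (leq_trans _ le_lX) //.
  apply: leq_trans (leq_card_setU _ _) _.
  by rewrite card_S -leq_subRL // core_le.
have [i XiS] : exists i, X i \subset S.
  apply/existsP; apply: contraT; rewrite negb_exists => /forallP nS.
  have {}nS i : exists2 x, x \in X i & x \notin S by apply/subsetPn.
  have [[x xX xS] [y yX yS] [z zX zS]] := And3 (nS part1) (nS part2) (nS part3).
  have inner i j u v : i != j -> u \in X i -> v \in X j ->
      u \notin S -> v \notin S -> core u v.
    move=> ij ui vj /negPf uS /negPf vS; have := joinX i j ij _ _ ui vj.
    by rewrite edgesG /base uS vS => /andP[/andP[]].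
  case: (@core_no_triangle x y z).
  - exact: inner xX yX xS yS.
  - exact: inner yX zX yS zS.
  - exact: inner xX zX xS zS.
have Xi := S_full i XiS.
have XnS j : i != j -> ~~ (X j \subset S).
  move=> ij; apply/negP => /S_full Xj.
  by apply: (not_both i j ij); rewrite ?Xi ?Xj.
(* If part [i] is the one of size [l], then [l = m] and any [j] will do. *)
have [j ij le_lX] : exists2 j, i != j & l <= #|X j|.
  have [i0|ni0] := eqVneq i part1; last by exists part1; rewrite ?cardX.
  exists part2; rewrite ?i0 ?cardX //=.
  by have := cardX i; rewrite Xi card_S i0 /= => ->.
have [k ki kj] := third i j.
apply: (not_both i j ij); first by rewrite Xi.
by apply: (absorbs k) => //; apply: XnS; rewrite eq_sym.
Qed.


Lemma base_S x y : col x != col y -> x \in S -> base x y.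
Proof. by rewrite /base => -> ->. Qed.

(** The end [y] in the larger class is the one known to have exactly [l - m]
    core neighbours in the class of [x]. Together with [x] and all but one
    vertex of the hub of that class, they form a part of size [l]. The vertices
    [sx] and [sy] left out of the hubs meet the two deleted edges that end in
    the third class, and by [d_stable] one of them meets the remaining one. *)
Lemma contains_add_core_edge x y :
  col x < col y -> x \notin S -> y \notin S -> ~~ core x y ->
  contains (complete_tripartite l m m) (add_edge G [set x; y]).
Proof.
move=> lt_xy xS yS cxy; have nxy : col x != col y by rewrite -val_eqE ltn_eqF.
have [z zx zy] := third (col x) (col y).
have [xz yz] : col x != z /\ col y != z by rewrite !(eq_sym _ z).
have xy2 : #|[set x; y]| == 2.
  by rewrite cards2 (contraNneq _ nxy) // => ->.
pose sx := d (col x) z; pose sy := d (col y) z.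
pose A := x |: ((S :&: V (col x)) :\ sx :|: N y (col x)).
pose C := y |: (S :&: V (col y)) :\ sy.
pose B := S :&: V z.
have sxS : sx \in S :&: V (col x) by rewrite !inE dS col_d /=.
have syS : sy \in S :&: V (col y) by rewrite !inE dS col_d /=.
have cardA : l <= #|A|.
  rewrite cardsU1 !inE (negPf xS) coreC (negPf cxy) !andbF /= add1n.
  rewrite cardsU (_ : _ :&: N _ _ = set0) ?cards0 ?subn0; last first.
    apply/setP => w; rewrite !inE; apply/negP => /andP[/and3P[_ wS _] /andP[_]].
    by rewrite coreC => /core_notS; rewrite wS.
  have := cardsD1 sx (S :&: V (col x)); rewrite sxS card_S core_eq //; lia.
have cardC : m <= #|C|.
  rewrite cardsU1 !inE (negPf yS) andbF /= add1n.
  by have := cardsD1 sy (S :&: V (col y)); rewrite syS card_S => ->.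
have colA a : a \in A -> col a = col x.
  by rewrite !inE => /or3P[/eqP-> //|/and3P[_ _ /eqP]|/andP[/eqP]].
have colC c : c \in C -> col c = col y.
  by rewrite !inE => /orP[/eqP-> //|/and3P[_ _ /eqP]].
have A_sx a : a \in A -> a != sx.
  rewrite !inE => /or3P[/eqP->|/andP[] //|/andP[_]].
    by apply: contraNneq xS => ->; apply: dS.
  by rewrite coreC => /core_notS; apply: contraNneq => ->; apply: dS.
have C_sy c : c \in C -> c != sy.
  rewrite !inE => /orP[/eqP->|/andP[] //].
  by apply: contraNneq yS => ->; apply: dS.
apply: (@contains_tripartite _ _ _ _ _ A B C); rewrite ?card_S //.
- move=> a b aA /setIP[bS]; rewrite [b \in _]inE => /eqP bz.
  rewrite in_add_edge // edgesG /base /deleted bz (colA a aA) bS xz.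
  by rewrite (negPf (A_sx a aA)) !orbT.
- move=> a c aA cC; rewrite in_add_edge // edgesG.
  have [acS|] := boolP ((a \in S) || (c \in S)).
    apply/orP; right; rewrite /base /deleted (colA a aA) (colC c cC) nxy.
    rewrite orbA acS /= negb_and.
    by have [->|->] := d_stable nxy xz yz; rewrite ?A_sx ?C_sy ?orbT.
  rewrite negb_or => /andP[aS cS].
  have -> : c = y by move: cC; rewrite !inE (negPf cS) /= andbF orbF => /eqP.
  move: aA; rewrite !inE (negPf aS) /= andbF /=.
  case/orP=> [/eqP->|/andP[/eqP ax ya]].
    by rewrite eqxx.
  rewrite /base /deleted ax nxy coreC ya !orbT /= orbC negb_and.
  by rewrite (contraNneq _ aS) // => ->.
- move=> b c /setIP[bS]; rewrite [b \in _]inE => /eqP bz cC.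
  rewrite in_add_edge // edgesG /base /deleted bz (colC c cC) bS zy.
  by rewrite (negPf (C_sy c cC)) andbF !orbT.
Qed.


(** The part of size [l] avoids the ends in the third class of the two edges
    that remain deleted; this is where two vertices more than [l] are needed in
    each class. *)
Lemma contains_add_deleted_edge x y :
  col x != col y -> deleted x y ->
  contains (complete_tripartite l m m) (add_edge G [set x; y]).
Proof.
move=> nxy /andP[/eqP xE /eqP yE].
have [z zx zy] := third (col x) (col y).
have xy2 : #|[set x; y]| == 2.
  by rewrite cards2 (contraNneq _ nxy) // => ->.
pose A := V z :\ d z (col x) :\ d z (col y).
have cardA : l <= #|A|.
  have := card_V z; rewrite (cardsD1 (d z (col x)) (V z)).
  by rewrite (cardsD1 (d z (col y)) (V z :\ _)) -/A; lia.
have joinA i : z != i -> d z i \notin A ->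
    joined (add_edge G [set x; y]) A (S :&: V i).
  move=> zi diA a s aA /setIP[sS]; rewrite [s \in _]inE => /eqP si.
  have /eqP az : col a == z by move: aA; rewrite !inE => /and3P[].
  rewrite in_add_edge // edgesG /base /deleted az si zi sS /= orbT /= negb_and.
  by rewrite (contraNneq _ diA) ?orbT // => <-.
apply: (@contains_tripartite _ _ _ _ _ A (S :&: V (col x)) (S :&: V (col y)));
  rewrite ?card_S //.
- by apply: joinA; rewrite // !inE eqxx andbF.
- by apply: joinA; rewrite // !inE eqxx.
move=> a b /setIP[aS]; rewrite [a \in _]inE => /eqP ax /setIP[bS].
rewrite [b \in _]inE => /eqP bz.
rewrite in_add_edge // edgesG /base /deleted ax bz nxy aS /= -xE -yE eq_set2.
by case: (a == x); case: (b == y); rewrite ?orbT.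
Qed.

Theorem saturated_trimmed (H : sgraph T) :
  (forall x y, ([set x; y] \in edges H) = (col x != col y)) ->
  saturated H (complete_tripartite l m m) G.
Proof.
move=> edgesH; apply/and3P; split; last 1 first.
- apply/forall_inP => e; rewrite inE => /andP[nGe He].
  have /cards2P[x [y [_ eE]]] := card_edge He; rewrite {e}eE edgesH in nGe He *.
  move: nGe; rewrite edgesG negb_and negbK orbC.
  case/orP=> [/contains_add_deleted_edge-> //|].
  rewrite /base He /= !negb_or => /and3P[xS yS ncore].
  case: (ltngtP (col x) (col y)) => [lt_xy|lt_yx|/val_inj]; last 1 first.
  + by move/eqP; rewrite (negPf He).
  + exact: contains_add_core_edge.
  + by rewrite setUC contains_add_core_edge // coreC.
- apply/subsetP => e eG; have /cards2P[x [y [_ eE]]] := card_edge eG.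
  by rewrite eE in eG *; rewrite edgesH edge_col.
- exact: contains_trimmed_free.
Qed.

(** Each edge is counted at its end in the class of larger index. A vertex of
    [S] sees at most the whole lower class, any other vertex at most [l] of its
    vertices, and one edge is lost to deletion for each pair of classes. *)
Lemma card_trimmed_edges :
  #|edges G| + 3 <=
    m * (2 * #|V part1| + #|V part2|) +
    l * ((#|V part2| - m) + 2 * (#|V part3| - m)).
Proof.
pose P q p := [set xy | [&& col xy.1 == q, col xy.2 == p &
                            [set xy.1; xy.2] \in edges G]].
pose Q (q p : 'I_3) :=
  [set xy | [&& col xy.1 == q, col xy.2 == p & base xy.1 xy.2]].
have cardQ (q p : 'I_3) : p < q -> #|Q q p| <= m * #|V p| + l * (#|V q| - m).
  move=> pq; have nqp : q != p by rewrite -val_eqE gtn_eqF.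
  have sub : Q q p \subset setX (S :&: V q) (V p) :|:
      \bigcup_(x in V q :\: S) setX [set x] (S :&: V p :|: N x p).
    apply/subsetP => -[x y]; rewrite !inE /= => /and3P[xq yp].
    case: (boolP (x \in S)) => xS; rewrite /base ?xq ?yp //= (negPf xS).
    case/andP=> _ xy; apply/bigcupP; exists x; first by rewrite !inE xS.
    by rewrite !inE yp eqxx andbT.
  apply: leq_trans (subset_leq_card sub) _.
  apply: leq_trans (leq_card_setU _ _) _; rewrite cardsX card_S leq_add2l.
  apply: leq_trans (card_bigcup_le _ _) _.
  apply: leq_trans (_ : \sum_(x in V q :\: S) l <= _).
    apply: leq_sum => x; rewrite inE => /andP[_ _].
    rewrite cardsX cards1 mul1n; apply: leq_trans (leq_card_setU _ _) _.
    by rewrite card_S -leq_subRL // core_le.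
  by rewrite sum_nat_const mulnC cardsD setIC card_S.
have cardP (q p : 'I_3) : p < q ->
    #|P q p| + 1 <= m * #|V p| + l * (#|V q| - m).
  move=> pq; have nqp : q != p by rewrite -val_eqE gtn_eqF.
  apply: leq_trans (cardQ q p pq); rewrite (cardsD1 (d q p, d p q) (Q q p)).
  rewrite addnC leq_add //.
    by rewrite inE /= !col_d !eqxx base_S // !col_d.
  apply: subset_leq_card; apply/subsetP=> -[x y].
  rewrite !inE /= edgesG /deleted.
  by case/and4P=> /eqP-> /eqP-> ->; rewrite xpair_eqE => ->; rewrite !eqxx.
have sub : edges G \subset [set [set xy.1; xy.2] | xy in
    P part2 part1 :|: P part3 part1 :|: P part3 part2].
  apply/subsetP => e eG; have /cards2P[x [y [_ eE]]] := card_edge eG.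
  rewrite {e}eE in eG *; have := edge_col eG.
  wlog lt_yx : x y eG / col y < col x.
    move=> IH.
    case: (ltngtP (col y) (col x)) => [/IH|lt_xy ne|/val_inj->]; auto.
      by rewrite setUC IH // 1?eq_sym // setUC.
    by rewrite eqxx.
  move=> _; apply/imsetP; exists (x, y) => //; rewrite !inE eG !andbT.
  by move: (col x) (col y) lt_yx => [[|[|[|]]]] // ? [[|[|[|]]]].
have := leq_trans (subset_leq_card sub) (leq_imset_card _ _).
have [+ _] := leq_card_setU (P part2 part1 :|: P part3 part1) (P part3 part2).
have [+ _] := leq_card_setU (P part2 part1) (P part3 part1).
have := cardP part2 part1 isT; have := cardP part3 part1 isT.
have := cardP part3 part2 isT; lia.
Qed.

End Trimmed.

(** * The hub and the core of the construction *)

Lemma modn_lt_double s N : s < N + N -> s %% N = if s < N then s else s - N.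
Proof.
move=> s2N; case: ltnP => [/modn_small //|le_Ns].
by rewrite -{1}(subnK le_Ns) modnDr modn_small //; lia.
Qed.

Section Construction.

Variables (l m n1 n2 n3 : nat).
Hypotheses (m_gt0 : 0 < m) (le_ml : m <= l).
Hypotheses (le_n21 : n2 <= n1) (le_n32 : n3 <= n2).
Hypothesis n3_ge : maxn (l + 2) (3 * l - 2 * m - 1) <= n3.

Let V : finType := tripartite n1 n2 n3.
Let n : 'I_3 -> nat := sizes n1 n2 n3.
Let N i := n i - m.
Let idx (x : V) : nat := tagged x.

Lemma size_ge i : l + 2 <= n i /\ 3 * l - 2 * m - 1 <= n i.
Proof.
move: n3_ge; rewrite geq_max.
by case: i => [[|[|[|]]]] //= ?; rewrite /n /sizes /=; lia.
Qed.

Lemma size_anti (p q : 'I_3) : p <= q -> n q <= n p.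
Proof.
by case: p q => [[|[|[|]]]] // ? [[|[|[|]]]] // ?; rewrite /n /sizes /=; lia.
Qed.

Lemma size_gt0 i : 0 < n i.
Proof. by case: (size_ge i); lia. Qed.

Lemma idx_lt x : idx x < n (part x).
Proof. exact: ltn_ord. Qed.

Lemma vtx_inj (x y : V) : part x = part y -> idx x = idx y -> x = y.
Proof.
case: x y => [i s] [j t]; rewrite /part /idx /= => ij.
by rewrite -{j}ij in t * => st; congr existT; apply: val_inj.
Qed.

(** The index is reduced modulo [n i] to make [vtx] total. *)
Definition vtx i s : V :=
  Tagged (fun i => 'I_(n i)) (Ordinal (ltn_pmod s (size_gt0 i))).

Lemma idx_vtx i s : s < n i -> idx (vtx i s) = s.
Proof. exact: modn_small. Qed.

Lemma card_indices i k (g : 'I_k -> nat) :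
  injective g -> (forall s, g s < n i) ->
  #|[set x : V | (part x == i) && [exists s, idx x == g s]]| = k.
Proof.
move=> g_inj g_lt; rewrite -[RHS]card_ord -cardsT.
rewrite -(card_imset _ (_ : injective (fun s => vtx i (g s)))); last first.
  by move=> s t /(congr1 idx); rewrite !idx_vtx // => /g_inj.
apply: eq_card => x; rewrite !inE.
apply/andP/imsetP => [[/eqP xi /existsP[s /eqP xs]]|[s _ ->]].
  by exists s => //; apply: vtx_inj; rewrite ?idx_vtx.
by rewrite eqxx; split=> //; apply/existsP; exists s; rewrite idx_vtx.
Qed.

Lemma card_part i : #|[set x : V | part x == i]| = n i.
Proof.
rewrite -(@card_indices i _ (@nat_of_ord (n i))) //; last exact: ord_inj.
apply: eq_card => x; rewrite !inE; case: eqP => //= <-; apply/esym/existsP.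
by exists (tagged x).
Qed.

Definition hub : {set V} := [set x | inS m x].

Lemma in_hub x : (x \in hub) = (N (part x) <= idx x).
Proof. by rewrite inE. Qed.

Lemma card_hub i : #|hub :&: [set x | part x == i]| = m.
Proof.
have [le_n _] := size_ge i.
rewrite -(@card_indices i m (fun s => N i + s)).
- apply: eq_card => x; rewrite in_setI in_hub !inE andbC; case: eqP => //= xi.
  apply/idP/existsP => [le_Nx|[s /eqP->]]; last by rewrite xi leq_addr.
  have lt_xm : idx x - N i < m.
    by have := idx_lt x; rewrite /N in le_Nx *; rewrite xi; lia.
  by exists (Ordinal lt_xm); rewrite /= subnKC // -xi.
- by move=> s t /addnI/val_inj.
- by move=> s; rewrite /N; have := ltn_ord s; lia.
Qed.

(** Core edges are oriented from the larger to the smaller part index, so that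
    both rules that define them become one: [x] jumps to the [l - m] indices
    that follow its own, shifted by [offset]. *)
Definition offset (q : 'I_3) : nat := if q == part3 then 0 else l - m.

Definition jump (x y : V) : bool :=
  [&& part y < part x, idx x < N (part x) &
    [exists k : 'I_(l - m),
       idx y == (idx x + offset (part x) + k) %% N (part y)]].

Lemma join_jump x y : join1 l m x y || join2 l m x y = jump x y.
Proof.
have ord3 (i : 'I_3) : [|| i == part1, i == part2 | i == part3].
  by case: i => [[|[|[|]]]].
rewrite /join1 /join2 /jump /offset /wrap /sup -/(idx x) -/(idx y).
have := ord3 (part x); have := ord3 (part y).
by case/or3P=> /eqP-> /or3P[]/eqP->; rewrite /= ?orbF ?andbF ?addn0.
Qed.

Definition core x y := jump x y || jump y x.

Lemma coreC : symmetric core.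
Proof. by move=> x y; apply: orbC. Qed.

Lemma core_size_gt0 i : 0 < N i.
Proof. by have [] := size_ge i; rewrite /N; lia. Qed.

Lemma jump_hub x y : jump x y -> (x \notin hub) && (y \notin hub).
Proof.
case/and3P=> _ lt_x /existsP[k /eqP yE].
by rewrite !in_hub -!ltnNge lt_x yE ltn_pmod // core_size_gt0.
Qed.

Lemma core_hub x y : core x y -> x \notin hub.
Proof. by case/orP => /jump_hub/andP[]. Qed.

Lemma core_part x y : core x y -> part x != part y.
Proof.
by rewrite -val_eqE /= neq_ltn; case/orP => /and3P[-> _ _]; rewrite ?orbT.
Qed.

Lemma jumpsE x (i : 'I_3) : x \notin hub -> i < part x ->
  #|[set y | (part y == i) && jump x y]| = l - m.
Proof.
rewrite in_hub -ltnNge => lt_x lt_i; have [le_n1 le_n2] := size_ge i.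
rewrite -(@card_indices i _ (fun k : 'I_(l - m) =>
  (idx x + offset (part x) + k) %% N i)).
- apply: eq_card => y; rewrite !inE /jump lt_x.
  by case: eqP => //= ->; rewrite lt_i.
- move=> s t /eqP; rewrite eqn_modDl !modn_small => [/eqP/val_inj //||].
    by rewrite /N; have := ltn_ord t; lia.
  by rewrite /N; have := ltn_ord s; lia.
- by move=> s; apply: leq_trans (ltn_pmod _ (core_size_gt0 i)) (leq_subr _ _).
Qed.

(** Each of the [l - m] steps reaches [y] from at most one vertex of part [i]:
    the indices of part [i] outside the hub are smaller than the modulus, which
    is that of the part of [y], because the sizes decrease with the index. *)
Lemma jumped_le y (i : 'I_3) : #|[set x | (part x == i) && jump x y]| <= l - m.
Proof.
pose F (k : 'I_(l - m)) := [set x |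
  [&& part x == i, part y < part x, idx x < N i &
      idx y == (idx x + offset i + k) %% N (part y)]].
apply: (@leq_trans #|\bigcup_(k in 'I_(l - m)) F k|).
  apply: subset_leq_card; apply/subsetP => x; rewrite inE => /andP[/eqP xi].
  case/and3P=> lt_yx lt_x /existsP[k xy]; apply/bigcupP; exists k => //.
  by rewrite inE -xi eqxx lt_yx lt_x.
apply: leq_trans (card_bigcup_le _ _) _.
rewrite -[leqRHS]card_ord -[leqRHS]sum1_card; apply: leq_sum => k _.
apply/card_le1_eqP => x x'; rewrite !inE.
case/and4P=> /eqP xi lt_yx lt_x /eqP-> /and4P[/eqP x'i _ lt_x'].
have le_N : N i <= N (part y) by rewrite leq_sub2r // size_anti // ltnW // -xi.
rewrite -!addnA eqn_modDr !modn_small ?(leq_trans _ le_N) // => /eqP xx'.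
by apply: vtx_inj; rewrite ?xi.
Qed.

Lemma core_degree x i :
  [set y in [set y | part y == i] | core x y] =
    if i < part x then [set y | (part y == i) && jump x y]
    else [set y | (part y == i) && jump y x].
Proof.
apply/setP=> y; case: ifP => lt_i; rewrite !inE; case: eqP => //= yi.
  by rewrite /core [X in _ || X]/jump yi ltnNge ltnW ?orbF.
by rewrite /core /jump yi lt_i.
Qed.

Lemma core_degree_le x i :
  #|[set y in [set y | part y == i] | core x y]| <= l - m.
Proof.
rewrite core_degree; case: ifP => lt_i; last exact: jumped_le.
have [xS|/jumpsE->//] := boolP (x \in hub).
rewrite (_ : [set _ | _] = set0) ?cards0 //; apply/setP=> y; rewrite !inE.
by apply/negP => /andP[_ /jump_hub]; rewrite xS.
Qed.

Lemma core_degree_eq x (i : 'I_3) : x \notin hub -> i < part x ->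
  #|[set y in [set y | part y == i] | core x y]| = l - m.
Proof. by move=> xS lt_i; rewrite core_degree lt_i jumpsE. Qed.

(** Modulo N_1 = n_1 - m, the index of [z] exceeds that of [x] by [k''] directly
    and by [k + (l - m) + k'], possibly minus N_2 = n_2 - m, through [y]. The
    difference of the two shifts is between 1 and 3 (l - m) - 2 without the wrap
    in the part of [y], and between 1 and N_2 - 1 in absolute value with it,
    hence not 0 modulo N_1, as 3 (l - m) - 1 <= N_2 <= N_1. *)
Lemma jump_no_triangle x y z : jump x y -> jump y z -> jump x z -> False.
Proof.
case/and3P=> lt_yx lt_x /existsP[k /eqP yE].
case/and3P=> lt_zy lt_y /existsP[k' /eqP zE].
case/and3P=> lt_zx _ /existsP[k'' /eqP].
have [x3 y2] : part x = part3 /\ part y = part2.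
  by split; apply: val_inj; move: lt_yx lt_zy (ltn_ord (part x)) => /=; lia.
have [le_n1 le_n2] := size_ge (part y).
have [le_Nxy le_Nyz] : N (part x) <= N (part y) /\ N (part y) <= N (part z).
  by split; rewrite leq_sub2r // size_anti // ltnW.
rewrite zE; rewrite {zE}yE /offset x3 y2 /= addn0 in lt_x le_Nxy le_Nyz *.
have := (ltn_ord k, ltn_ord k', ltn_ord k'').
rewrite /= y2 in le_n1 le_n2; rewrite -/(N part2) in le_n1 le_n2 *.
have le_N2 : 3 * (l - m) <= (N part2).+1 by rewrite /N; lia.
case=> [[lt_k lt_k'] lt_k''].
rewrite (@modn_lt_double (_ + k)); last by lia.
rewrite (@modn_lt_double (_ + k'')); last by lia.
rewrite (@modn_lt_double (_ + k')); last by case: ifP; lia.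
by do 3 case: ifP; lia.
Qed.

(** The two cyclic orientations of a triangle are impossible, and the six others
    reduce to [jump_no_triangle]. *)
Lemma core_no_triangle x y z : core x y -> core y z -> core x z -> False.
Proof.
case/orP=> xy /orP[]yz /orP[]xz.
- exact: jump_no_triangle xy yz xz.
- by case/and3P: xy yz xz => + _ _ /and3P[+ _ _] /and3P[+ _ _]; lia.
- exact: jump_no_triangle xz yz xy.
- exact: jump_no_triangle xz xy yz.
- exact: jump_no_triangle xy xz yz.
- exact: jump_no_triangle yz xz xy.
- by case/and3P: xy yz xz => + _ _ /and3P[+ _ _] /and3P[+ _ _]; lia.
- exact: jump_no_triangle yz xy xz.
Qed.

Lemma edges_complete (x y : V) :
  ([set x; y] \in edges (complete_tripartite n1 n2 n3)) = (part x != part y).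
Proof.
rewrite in_of_rel [part y == _]eq_sym orbb andb_idl //.
by apply: contraNneq => ->.
Qed.

Lemma edges_base (x y : V) :
  ([set x; y] \in edges (base_graph l m n1 n2 n3)) =
    (part x != part y) && [|| x \in hub, y \in hub | core x y].
Proof.
rewrite in_of_rel !join_jump [part y == _]eq_sym /core !in_set.
have [->|nxy] := eqVneq x y; first by rewrite eqxx.
have [xy|] := boolP (jump x y || jump y x).
  by rewrite core_part // !orbT /=; case/orP: xy => ->; rewrite ?orbT.
rewrite negb_or => /andP[/negPf-> /negPf->].
by rewrite !orbF -andb_orl /= andbC.
Qed.

Lemma edges_edge_at i s j t (x y : V) :
  ([set x; y] \in edge_at n1 n2 n3 i s j t) =
    [&& part x == i, sup x == s, part y == j & sup y == t] ||
    [&& part y == i, sup y == s, part x == j & sup x == t].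
Proof.
apply/imsetP/orP => [[[u v]]|[xy|yx]].
- rewrite inE /= => uv /eqP; rewrite eq_set2.
  by case/orP=> /andP[/eqP-> /eqP->]; auto.
- by exists (x, y); rewrite ?inE.
- by exists (y, x); rewrite ?inE //= setUC.
Qed.

(** * The three deleted edges *)

Section Trim.

Variables (c : nat) (i j k : 'I_3).
Hypotheses (lt_cm : c < m) (ij : i != j) (ik : i != k) (jk : j != k).

(** This is G_1 for [c = 0] and (i, j, k) = (1, 2, 3), and G_2^i for [c = 1] and
    (i, i + 1, i + 2). *)
Definition trim : sgraph V :=
  del_edges (base_graph l m n1 n2 n3)
    (edge_at n1 n2 n3 i (n i) j (n j) :|: edge_at n1 n2 n3 i (n i - c) k (n k)
       :|: edge_at n1 n2 n3 j (n j) k (n k)).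

(** The end in part [a] of the deleted edge between the parts [a] and [b], as
    required of [d] in the abstract setting. *)
Definition tip (a b : 'I_3) : V :=
  vtx a (n a - (if (a == i) && (b == k) then c else 0)).-1.

Lemma idx_tip a b :
  (idx (tip a b)).+1 = n a - (if (a == i) && (b == k) then c else 0).
Proof.
have [le_n _] := size_ge a; rewrite idx_vtx; first by case: ifP; lia.
by have := size_gt0 a; lia.
Qed.

Lemma tipE (x : V) b : (x == tip (part x) b) =
  (sup x == n (part x) - (if (part x == i) && (b == k) then c else 0)).
Proof.
rewrite -idx_tip eqSS; apply/eqP/eqP => [/(congr1 idx) //|xt].
exact: vtx_inj.
Qed.

(** The bound [c < m] is what keeps the vertex of superscript [n i - c] in the
    hub. *)
Lemma tip_hub a b : tip a b \in hub.
Proof.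
have [le_n _] := size_ge a; rewrite in_hub (_ : part _ = a) //.
by have := idx_tip a b; rewrite /N; case: ifP; lia.
Qed.

(** Only part [i] can have two different tips. *)
Lemma tip_stable a b e : a != b -> a != e -> b != e ->
  tip a b = tip a e \/ tip b a = tip b e.
Proof.
move=> ab ae be; rewrite /tip; have [ai|] := eqVneq a i; last by left.
by right; rewrite -ai eq_sym (negPf ab).
Qed.

Lemma edges_trim (x y : V) : ([set x; y] \in edges trim) =
  ((part x != part y) && [|| x \in hub, y \in hub | core x y]) &&
    ~~ ((x == tip (part x) (part y)) && (y == tip (part y) (part x))).
Proof.
rewrite in_del_edges edges_base andbC.
have [->//|nxy /=] := eqVneq (part x) (part y).
congr (_ && ~~ _); rewrite !inE !edges_edge_at !tipE.
have [[nij nik njk] [nji nki nkj]] :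
    [/\ (i == j) = false, (i == k) = false & (j == k) = false] /\
    [/\ (j == i) = false, (k == i) = false & (k == j) = false].
  by rewrite !(eq_sym _ i) (eq_sym k); do 2 split; apply: negbTE.
move: nxy; have := cover3 (part x) ij ik jk; have := cover3 (part y) ij ik jk.
case/or3P=> /eqP-> /or3P[]/eqP->; rewrite ?eqxx //= => _;
rewrite ?eqxx ?nij ?nik ?njk ?nji ?nki ?nkj /= ?subn0 ?orbF ?andbF //=;
by rewrite ?orbF andbC.
Qed.

Lemma saturated_trim :
  saturated (complete_tripartite n1 n2 n3) (complete_tripartite l m m) trim.
Proof.
apply: (saturated_trimmed m_gt0 le_ml card_hub _ coreC core_hub
  core_no_triangle core_degree_le core_degree_eq tip_hub _ tip_stable edges_trim
  edges_complete).
- by move=> a; rewrite card_part; case: (size_ge a).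
- by [].
Qed.

Lemma edge_count_identity : m <= n2 -> m <= n3 ->
  m * (2 * n1 + n2) + l * ((n2 - m) + 2 * (n3 - m)) + 3 * l * m =
    2 * m * (n1 + n2 + n3) + (l - m) * (n2 + 2 * n3).
Proof.
by move: le_ml => /subnKC<- /subnKC<- /subnKC<-; rewrite !addKn; lia.
Qed.

Lemma card_trim : #|edges trim| <=
  2 * m * (n1 + n2 + n3) + (l - m) * (n2 + 2 * n3) - 3 * l * m - 3.
Proof.
have := card_trimmed_edges m_gt0 le_ml card_hub core_degree_le
  tip_hub _ edges_trim.
rewrite !card_part /n /sizes /= => /(_ (fun _ _ => erefl)).
have [le_n _] := size_ge part3; rewrite /n /sizes /= in le_n.
have := edge_count_identity; lia.
Qed.

End Trim.

End Construction.

Theorem theorem1 (l m : nat) (m_gt0 : 0 < m) (l_gt0 : 0 < l) (le_ml : m <= l)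
  (n1 n2 n3 : nat) (le_n21 : n2 <= n1) (le_n32 : n3 <= n2)
  (n3_ge : maxn (l + 2) (3 * l - 2 * m - 1) <= n3) :
  [/\ saturated (complete_tripartite n1 n2 n3) (complete_tripartite l m m)
        (G1 l m n1 n2 n3),
      1 < m -> forall i : 'I_3,
        saturated (complete_tripartite n1 n2 n3) (complete_tripartite l m m)
          (G2 l m n1 n2 n3 i) &
      sat (complete_tripartite n1 n2 n3) (complete_tripartite l m m) <=
        2 * m * (n1 + n2 + n3) + (l - m) * (n2 + 2 * n3) - 3 * l * m - 3].
Proof.
have G1E : G1 l m n1 n2 n3 = trim l m n1 n2 n3 0 part1 part2 part3.
  by rewrite /trim subn0.
have G1_sat : saturated (complete_tripartite n1 n2 n3)
    (complete_tripartite l m m) (G1 l m n1 n2 n3).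
  by rewrite G1E; apply: saturated_trim.
split; first exact: G1_sat.
  move=> m_gt1 i; apply: (@saturated_trim l m n1 n2 n3 m_gt0 le_ml le_n21 le_n32
    n3_ge 1 i (ordS i) (ordS (ordS i)) m_gt1);
  by case: i => [[|[|[|]]]].
by apply: leq_trans (sat_le G1_sat) _; rewrite G1E; apply: card_trim.
Qed.
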